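(* Let $u,v\geq 2$ be integers and let $M=\begin{bmatrix} a & b\\ c & d\end{bmatrix}\in\mathscr{S}_{u,v}$. Then $M\in S_{u,v}$ if and only if $C(b/d)$ satisfies the $(u,v)$-divisibility property.
   Context: $\mathbb{N}$ denotes the set of nonnegative integers. For positive integers $u,v$ let $L_u=\begin{bmatrix}1 & 0\\ u & 1\end{bmatrix}$ and $R_v=\begin{bmatrix}1 & v\\ 0 & 1\end{bmatrix}$. $S_{u,v}$ is the monoid generated by $L_u$ and $R_v$ under matrix multiplication. Let $SL_2(\mathbb{N})$ be the set of $2\times 2$ matrices with entries in $\mathbb{N}$ and determinant $1$, and $$\mathscr{S}_{u,v}=\left\{\begin{bmatrix}1+uvn_1 & vn_2\\ un_3 & 1+uvn_4\end{bmatrix}\in SL_2(\mathbb{N}) : (n_1,n_2,n_3,n_4)\in\mathbb{N}^4\right\}.$$ For integers $q_0,\dots,q_r$, $[q_0,q_1,\dots,q_r]$ denotes the (possibly undefined) continued fraction $q_0+\cfrac{1}{q_1+\cfrac{1}{\ddots+\cfrac{1}{q_r}}}$. Every rational $x$ has a unique representation $x=[x_0,\dots,x_r]$ with all $x_i\in\mathbb{Z}$, $x_i\geq 1$ for $0<i<r$, and $x_r>1$ when $r>0$; this is the short continued fraction representation of $x$. Finite sequences of integers are written $\llbracket q_0,\dots,q_r\rrbracket$, and $C(x):=\llbracket x_0,\dots,x_r\rrbracket$ where $[x_0,\dots,x_r]$ is the short continued fraction representation of $x$. A sequence $\llbracket q_0,\dots,q_r\rrbracket$ satisfies the $(u,v)$-divisibility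 property if $v\mid q_i$ for every even index $i$ and $u\mid q_i$ for every odd index $i$ ($0\leq i\leq r$). *)

(* Defs.v *)
From mathcomp Require Import all_boot all_order all_algebra.
From mathcomp Require Import ring lra zify.

Set Implicit Arguments.
Unset Strict Implicit.
Unset Printing Implicit Defensive.

Import Order.TTheory GRing.Theory Num.Theory.
Local Open Scope ring_scope.

Definition mx2 (a b c d : int) : 'M[int]_2 :=
  \matrix_(i < 2, j < 2)
    if i == 0 then (if j == 0 then a else b) else (if j == 0 then c else d).

Definition Lmx (u : nat) : 'M[int]_2 := mx2 1 0 u%:Z 1.
Definition Rmx (v : nat) : 'M[int]_2 := mx2 1 v%:Z 0 1.

Inductive in_monoid (u v : nat) : 'M[int]_2 -> Prop :=
| in_monoid_1 : in_monoid u v 1%:M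
| in_monoid_L : in_monoid u v (Lmx u)
| in_monoid_R : in_monoid u v (Rmx v)
| in_monoid_M A B :
    in_monoid u v A -> in_monoid u v B -> in_monoid u v (A *m B).

Definition in_SL2N (M : 'M[int]_2) : Prop :=
  M \is a mxOver Num.nat /\ \det M = 1.

Definition in_scrS (u v : nat) (M : 'M[int]_2) : Prop :=
  in_SL2N M /\
  exists n1 n2 n3 n4 : nat,
    M = mx2 (1 + u * v * n1)%N%:Z (v * n2)%N%:Z
            (u * n3)%N%:Z         (1 + u * v * n4)%N%:Z.

(* None when the sequence is empty or some denominator vanishes. *)
Fixpoint cf_val (s : seq int) : option rat :=
  match s with
  | [::] => None
  | [:: q] => Some q%:Q
  | q :: s' =>
      if cf_val s' is Some y then
        (if y == 0 then None else Some (q%:Q + y^-1))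
      else None
  end.

(* With s = [:: x_0; ...; x_r], (size s).-1 is r and last 0 s is x_r. *)
Definition short_seq (s : seq int) : bool :=
  [forall i : 'I_(size s), (0 < i < (size s).-1)%N ==> (1 <= s`_i)]
  && ((0 < (size s).-1)%N ==> (1 < last 0 s)).

Definition short_cf (x : rat) (s : seq int) : bool :=
  short_seq s && (cf_val s == Some x).

Lemma short_seq1 q : short_seq [:: q].
Proof. by rewrite /short_seq /= andbT; apply/forallP => i; apply/implyP; case: i => [[]]. Qed.

Lemma short_seq_cons q p s :
  short_seq [:: q, p & s] =
  [&& short_seq (p :: s), 1 <= p & (size s == 0)%N ==> (1 < p)].
Proof.
rewrite /short_seq /=.
case: s => [|p' s] /=.
  rewrite andbT; apply/idP/idP.
    case/andP=> _ p1; rewrite p1 (ltW p1) !andbT.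
    by apply/forallP => i; apply/implyP; case: i => [[]].
  case/and3P=> _ _ ->; rewrite andbT.
  by apply/forallP => -[[|[|]]].
rewrite !andbT; apply/idP/idP.
  case/andP=> /forallP H ->; rewrite andbT; apply/andP; split.
    apply/forallP => i; apply/implyP => /andP[i0 iS].
    have lti : (i.+1 < (size s).+3)%N by have := ltn_ord i; rewrite /=; lia.
    by have /implyP := H (Ordinal lti); apply=> /=; lia.
  have lti : (1 < (size s).+3)%N by [].
  by have /implyP := H (Ordinal lti); apply.
case/andP=> /andP[/forallP H ->] p1; rewrite andbT.
apply/forallP => -[[|[|i]] //= lti]; apply/implyP => //= iS.
have lti' : (i.+1 < (size s).+2)%N by lia.
by have /implyP := H (Ordinal lti'); apply=> /=; lia.
Qed.

Lemma short_seq_val q s : short_seq (q :: s) ->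
  exists2 x, cf_val (q :: s) = Some x
           & if s is [::] then x = q%:Q else q%:Q < x < q%:Q + 1.
Proof.
elim: s q => [|p s IH] q; first by exists q%:Q.
rewrite short_seq_cons => /and3P[sp p1 sp1].
have [y Ey Hy] := IH _ sp.
have y1 : 1 < y.
  case: s {IH sp Ey} sp1 Hy => [/= p2 ->|p' s _ /andP[py _]].
    by rewrite ltr1z.
  by apply: le_lt_trans py; rewrite ler1z.
have y0 : 0 < y by apply: lt_trans y1.
exists (q%:Q + y^-1); first by rewrite [cf_val _]/= -/(cf_val (p :: s)) Ey gt_eqF.
by rewrite ltrDl invr_gt0 y0 ltrD2l invf_lt1.
Qed.

Lemma short_seq_tail_gt1 q p s : short_seq [:: q, p & s] ->
  exists2 y, cf_val (p :: s) = Some y & 1 < y.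
Proof.
rewrite short_seq_cons => /and3P[sp p1 sp1].
have [y Ey Hy] := short_seq_val sp; exists y => //.
case: s {sp Ey} sp1 Hy => [/= p2 ->|p' s _ /andP[py _]].
  by rewrite ltr1z.
by apply: le_lt_trans py; rewrite ler1z.
Qed.

Lemma short_cf_floor q s x : short_cf x (q :: s) -> Num.floor x = q.
Proof.
case/andP=> /short_seq_val[y -> Hy] /eqP[<-].
apply: floor_def; rewrite intrD.
case: s Hy => [->|_ _ /andP[/ltW -> ->]] //.
by rewrite lexx ltrDl.
Qed.

Lemma short_cf_cons q x s : 1 < x -> short_cf x s ->
  short_cf (q%:Q + x^-1) (q :: s).
Proof.
move=> x1; case: s => [/andP[_ /eqP //]|p s] /[dup] sh /andP[sp /eqP Ex].
have x0 : x != 0 by rewrite gt_eqF // (lt_trans _ x1).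
apply/andP; split; last by rewrite [cf_val _]/= -/(cf_val (p :: s)) Ex (negPf x0).
rewrite short_seq_cons sp /=; apply/andP; split.
  by rewrite -(short_cf_floor sh) floor_ge_int ltW.
case: s {sh sp} Ex => //= -[px]; by rewrite -px ltr1z in x1.
Qed.

Lemma short_cf_exists (x : rat) : exists s, short_cf x s.
Proof.
suff H : forall (n m : nat) (p : int), (0 < m <= n)%N ->
    exists s, short_cf (p%:Q / m%:Z%:Q) s.
  rewrite -[x]divq_num_den.
  have := H `|denq x|%N `|denq x|%N (numq x).
  rewrite absz_denq; apply; have := denq_gt0 x; lia.
elim=> [|n IH] m p mn; first by lia.
have m0 : m%:Z%:Q != 0 by rewrite intr_eq0; lia.
have Ep := divz_eq p m%:Z.
set r := (p %% m%:Z)%Z in Ep; set q := (p %/ m%:Z)%Z in Ep.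
have r0 : 0 <= r by rewrite modz_ge0 //; lia.
have rm : r < m%:Z by rewrite ltz_pmod //; lia.
have [rz|rn0] := eqVneq r 0.
  exists [:: q]; rewrite /short_cf short_seq1 /= Ep rz addr0 intrM mulfK //.
have rN : r = `|r|%N%:Z by lia.
have [|s sh] := IH `|r|%N m%:Z; first lia.
exists (q :: s); rewrite -rN in sh.
have rq0 : r%:Q != 0 by rewrite intr_eq0.
have -> : p%:Q / m%:Z%:Q = q%:Q + (m%:Z%:Q / r%:Q)^-1.
  by rewrite [p in p%:Q]Ep intrD intrM; field; rewrite m0 rq0.
apply: short_cf_cons => //.
by rewrite ltr_pdivlMr ?mul1r ?ltr_int // ltr0z lt_def rn0.
Qed.

Lemma short_cf_unique (x : rat) s t : short_cf x s -> short_cf x t -> s = t.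
Proof.
elim: s x t => [|q s IH] x [|q' t] // hs ht;
  do ?by [case/andP: hs => _ /eqP | case/andP: ht => _ /eqP].
have Eq := short_cf_floor hs; rewrite (short_cf_floor ht) in Eq; subst q'.
congr cons.
case/andP: hs => ss /eqP Es; case/andP: ht => st /eqP Et.
case: s IH ss Es => [|p s] IH ss Es; case: t st Et => [|p' t] st Et //.
- case: Es => Es; have [y] := short_seq_val st.
  by rewrite Et => -[<-]; rewrite -Es ltxx.
- case: Et => Et; have [y] := short_seq_val ss.
  by rewrite Es => -[<-]; rewrite -Et ltxx.
have [y Ey y1] := short_seq_tail_gt1 ss.
have [z Ez z1] := short_seq_tail_gt1 st.
have y0 : y != 0 by rewrite gt_eqF // (lt_trans _ y1).
have z0 : z != 0 by rewrite gt_eqF // (lt_trans _ z1).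
rewrite [cf_val _]/= -/(cf_val (p :: s)) Ey (negPf y0) in Es.
rewrite [cf_val _]/= -/(cf_val (p' :: t)) Ez (negPf z0) -Es in Et.
case: Et => /addrI /invr_inj zy; subst z.
rewrite !short_seq_cons in ss st.
case/and3P: ss => ss _ _; case/and3P: st => st _ _.
by apply: (IH y); rewrite /short_cf ?ss ?st ?Ey ?Ez eqxx.
Qed.

Definition cf_seq (x : rat) : seq int := xchoose (short_cf_exists x).

Lemma cf_seqP (x : rat) : short_cf x (cf_seq x).
Proof. exact: xchooseP. Qed.

Lemma cf_seq_eq (x : rat) s : short_cf x s -> cf_seq x = s.
Proof. exact/short_cf_unique/cf_seqP. Qed.

Definition uv_divisible (u v : nat) (s : seq int) : Prop :=
  forall i : nat, (i < size s)%N ->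
    if odd i then (u%:Z %| s`_i)%Z else (v%:Z %| s`_i)%Z.

(* Main.v *)
Require Import Defs.
From mathcomp Require Import all_boot all_order all_algebra.
From mathcomp Require Import ring lra zify.
Import Order.TTheory GRing.Theory Num.Theory.
Local Open Scope ring_scope.

(** A matrix acts on the nonnegative rationals by
    [x |-> (a x + b) / (c x + d)], and [b / d] is the image of [0].  The
    generator [R_v] acts as [x |-> x + v], and [L_u] acts as
    [x |-> (x^-1 + u)^-1], the conjugate of [x |-> x + u] by inversion.

    Divisibility of the short continued fraction is unchanged by both maps,
    in both directions.  Adding a multiple of [v] only changes the first
    partial quotient by a multiple of [v] ([cf_divisibleD]).  Inversion inserts
    or removes a leading [0], so it shifts the indices by one and exchanges the
    roles of [u] and [v] ([cf_divisibleV]); the only number where this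
    could go wrong is [1], which is divisible in neither sense because
    [u, v >= 2].

    Hence every product of generators sends [0] to a divisible number.
    Conversely, if [b / d] is divisible and positive, its first nonzero
    partial quotient is at least [v] (when [b / d >= 1]) or at least [u] (when
    [b / d < 1]), see [cf_divisible_ge].  This is exactly what is required for
    [R_v^-1 M] or [L_u^-1 M] to have nonnegative entries again; its quotient
    [b / d] is still divisible and [b + d] is smaller, so the descent ends at a
    matrix with [b = 0], which is a power of [L_u]. *)

Definition cf_divisible (u v : nat) (x : rat) : Prop :=
  uv_divisible u v (cf_seq x).

Lemma uv_divisible_cons u v q s :
  uv_divisible u v (q :: s) <-> (v%:Z %| q)%Z /\ uv_divisible v u s.
Proof.
split=> [H|[Hq Hs] [|i] // lti]; last first.
  by have := Hs i lti; rewrite /=; case: (odd i).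
split=> [|i lti]; first exact: (H 0%N).
by have := H i.+1 lti; rewrite /=; case: (odd i).
Qed.

Lemma cf_divisible_floor u v x :
  cf_divisible u v x -> (v%:Z %| Num.floor x)%Z.
Proof.
rewrite /cf_divisible; have := cf_seqP x.
case: (cf_seq x) => [/andP[_ /eqP]|q s sh] //.
by rewrite (short_cf_floor sh) => /uv_divisible_cons[].
Qed.

(** Divisibility by [v] leaves no room between [0] and [v] for a positive
    first partial quotient. *)
Lemma cf_divisible_ge u v x : 1 <= x -> cf_divisible u v x -> v%:Q <= x.
Proof.
move=> x1 /cf_divisible_floor vq.
have q1 : 1 <= Num.floor x by rewrite floor_ge_int.
rewrite -floor_ge_int.
case/dvdzP: vq q1 => k -> kv1.
have k0 : 0 < k by nia.
nia.
Qed.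

Lemma short_cfD x q s (k : int) :
  short_cf x (q :: s) -> short_cf (x + k%:Q) (q + k :: s).
Proof.
case: s => [|p s] /andP[sh /eqP Ex]; apply/andP.
  by rewrite short_seq1; case: Ex => <-; rewrite /= intrD.
rewrite short_seq_cons in sh; rewrite short_seq_cons sh; split=> //.
move: Ex; rewrite ![cf_val [:: _, _ & _]]/= -/(cf_val (p :: s)).
case: (cf_val (p :: s)) => // y; case: eqP => // _ [<-].
by rewrite intrD addrAC.
Qed.

Lemma cf_divisibleD u v x (k : int) : (v%:Z %| k)%Z ->
  cf_divisible u v (x + k%:Q) <-> cf_divisible u v x.
Proof.
move=> vk.
have shift y l : (v%:Z %| l)%Z ->
    cf_divisible u v y -> cf_divisible u v (y + l%:Q).
  rewrite /cf_divisible; have := cf_seqP y.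
  case: (cf_seq y) => [/andP[_ /eqP]|q s sh] // vl /uv_divisible_cons[vq Hs].
  rewrite (cf_seq_eq (short_cfD _ _ _ l sh)).
  by apply/uv_divisible_cons; rewrite rpredD.
split; last exact: shift.
by move/(shift _ (- k)); rewrite rpredN mulrNz addrK; apply.
Qed.

Lemma cf_divisible0 u v : cf_divisible u v 0.
Proof.
rewrite /cf_divisible (@cf_seq_eq 0 [:: 0]).
  by rewrite uv_divisible_cons dvdz0.
by rewrite /short_cf short_seq1.
Qed.

Lemma cf_divisible1 u v : (2 <= v)%N -> ~ cf_divisible u v 1.
Proof.
by move=> v2 /cf_divisible_ge-/(_ (lexx _)); rewrite lerz1; lia.
Qed.

Lemma cf_divisibleV_gt1 u v x : 1 < x ->
  cf_divisible v u x^-1 <-> cf_divisible u v x.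
Proof.
move=> x1; rewrite /cf_divisible.
have -> : cf_seq x^-1 = 0 :: cf_seq x.
  apply: cf_seq_eq; rewrite -[x^-1]add0r.
  exact: short_cf_cons (cf_seqP x).
by rewrite uv_divisible_cons dvdz0; split=> [[]|].
Qed.

(** The case [x < 1] is the case [x > 1] read backwards, since inversion is an
    involution.  At [x = 0] the statement uses the convention [0^-1 = 0]. *)
Lemma cf_divisibleV u v x : (2 <= u)%N -> (2 <= v)%N -> 0 <= x ->
  cf_divisible v u x^-1 <-> cf_divisible u v x.
Proof.
move=> u2 v2; rewrite le_eqVlt => /predU1P[<-|x0].
  by rewrite invr0; split=> _; exact: cf_divisible0.
have [x1|x1|->] := ltgtP x 1; last 2 first.
- exact: cf_divisibleV_gt1.
- by rewrite invr1; split=> /cf_divisible1 H; case: H.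
have := cf_divisibleV_gt1 v u x^-1; rewrite invrK invf_gt1 // => H.
by symmetry; exact: H.
Qed.

(** The action of [L_u] is that of [R_u] conjugated by inversion. *)
Lemma cf_divisible_Lmx u v (x : rat) : (2 <= u)%N -> (2 <= v)%N -> 0 <= x ->
  cf_divisible u v (x / (u%:Q * x + 1)) <-> cf_divisible u v x.
Proof.
move=> u2 v2; rewrite le_eqVlt => /predU1P[<-|x0]; first by rewrite mul0r.
have u0 : 0 <= u%:Q by rewrite ler0z.
have -> : x / (u%:Q * x + 1) = (x^-1 + u%:Q)^-1.
  field; rewrite gt_eqF //=; nra.
rewrite cf_divisibleV //; last by rewrite addr_ge0 // invr_ge0 ltW.
by rewrite cf_divisibleD // cf_divisibleV // ltW.
Qed.

Lemma mx2_mul a b c d a' b' c' d' :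
  mx2 a b c d *m mx2 a' b' c' d' =
  mx2 (a * a' + b * c') (a * b' + b * d') (c * a' + d * c') (c * b' + d * d').
Proof.
apply/matrixP => i j; rewrite !mxE !big_ord_recl big_ord0 !mxE /= addr0.
by case: i => [[|[|]]] // ?; case: j => [[|[|]]].
Qed.

Lemma mx2_det a b c d : \det (mx2 a b c d) = a * d - b * c.
Proof.
rewrite (expand_det_row _ ord0) !big_ord_recl big_ord0 /cofactor !det_mx11 !mxE.
by rewrite /= addr0 expr0 expr1 mul1r mulN1r mulrN.
Qed.

Definition mobius_num (M : 'M[int]_2) (x : rat) : rat :=
  (M 0 0)%:Q * x + (M 0 1)%:Q.

Definition mobius_den (M : 'M[int]_2) (x : rat) : rat :=
  (M 1 0)%:Q * x + (M 1 1)%:Q.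

(** The positivity of the denominator is carried along because it is what makes
    the action of a product the composite of the actions. *)
Lemma in_monoid_mobius u v M x : (2 <= u)%N -> (2 <= v)%N ->
  in_monoid u v M -> 0 <= x -> cf_divisible u v x ->
  [/\ 0 <= mobius_num M x, 0 < mobius_den M x
    & cf_divisible u v (mobius_num M x / mobius_den M x)].
Proof.
move=> u2 v2 HM; elim: HM x => [|||A B _ IHA _ IHB] x x0 Hx.
- by rewrite /mobius_num /mobius_den !mxE /= mul1r mul0r add0r addr0 divr1.
- rewrite /mobius_num /mobius_den !mxE /= mul1r addr0; split=> //.
    by rewrite ltr_wpDl // mulr_ge0.
  exact/cf_divisible_Lmx.
- rewrite /mobius_num /mobius_den !mxE /= mul1r mul0r add0r divr1.
  split=> //; first by rewrite addr_ge0.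
  exact/cf_divisibleD.
have [nB dB divB] := IHB x x0 Hx.
set y := mobius_num B x / mobius_den B x in divB.
have Ey : mobius_num B x = y * mobius_den B x by rewrite divfK ?gt_eqF.
have [nA dA divA] := IHA y (divr_ge0 nB (ltW dB)) divB.
have mulE i : (((A *m B) i 0)%:Q * x + ((A *m B) i 1)%:Q)
            = ((A i 0)%:Q * y + (A i 1)%:Q) * mobius_den B x.
  rewrite mulrDl -mulrA -Ey /mobius_num /mobius_den !mxE.
  rewrite !big_ord_recl !big_ord0 !addr0 (_ : lift ord0 ord0 = 1) ?ord1 //;
    last exact: val_inj.
  by rewrite !intrD !intrM; ring.
rewrite /mobius_num /mobius_den !mulE -/(mobius_num A y) -/(mobius_den A y).
split; [exact: mulr_ge0 nA (ltW dB) | exact: mulr_gt0 |].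
by rewrite -mulf_div divff ?mulr1 // gt_eqF.
Qed.

Lemma in_monoid_Lmx_pow u v (n : nat) : in_monoid u v (mx2 1 0 (u%:Z * n%:Z) 1).
Proof.
elim: n => [|n IH].
  suff -> : mx2 1 0 (u%:Z * 0%N%:Z) 1 = 1%:M by exact: in_monoid_1.
  apply/matrixP => i j; rewrite !mxE mulr0.
  by case: i => [[|[|]]] // ?; case: j => [[|[|]]].
have -> : mx2 1 0 (u%:Z * n.+1%:Z) 1 = Lmx u *m mx2 1 0 (u%:Z * n%:Z) 1.
  by rewrite mx2_mul; congr mx2; lia.
exact: in_monoid_M (in_monoid_L _ _) IH.
Qed.

(** Descent on [b + d], splitting off generators on the left.  The congruence
    [u | c] excludes [d = u b], for which [L_u^-1 M] would have a vanishing
    lower right entry: [u] would then divide the determinant. *)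
Lemma in_monoid_of_cf_divisible u v (a b c d : int) :
  (2 <= u)%N -> (2 <= v)%N ->
  0 < a -> 0 <= b -> 0 <= c -> 0 < d -> a * d - b * c = 1 -> (u%:Z %| c)%Z ->
  cf_divisible u v (b%:Q / d%:Q) -> in_monoid u v (mx2 a b c d).
Proof.
move=> u2 v2; have [n] := ubnP (absz (b + d)).
elim: n a b c d => // n IH a b c d bdn a0 b0 c0 d0 det /dvdzP[k Ek] Hdiv.
have dQ : 0 < d%:Q by rewrite ltr0z.
have [bz|bn0] := eqVneq b 0.
  have [-> ->] : a = 1 /\ d = 1 by rewrite bz in det; nia.
  rewrite bz Ek mulrC (_ : k = `|k|%N%:Z); first exact: in_monoid_Lmx_pow.
  nia.
have bQ : 0 < b%:Q by rewrite ltr0z lt_def bn0.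
have [db|bd] := lerP d b.
  (* The quotient is at least 1, so R_v splits off on the left. *)
  have vdb : v%:Z * d <= b.
    have x1 : 1 <= b%:Q / d%:Q by rewrite ler_pdivlMr // mul1r ler_int.
    have := cf_divisible_ge _ _ _ x1 Hdiv.
    by rewrite ler_pdivlMr // -intrM ler_int.
  have -> : mx2 a b c d = Rmx v *m mx2 (a - v%:Z * c) (b - v%:Z * d) c d.
    by rewrite mx2_mul; congr mx2; ring.
  apply: in_monoid_M (in_monoid_R _ _) _; apply: IH => //.
  - nia.
  (* The lower bound on [b] controls the first column through the determinant. *)
  - have : 0 < d * (a - v%:Z * c).
      have -> : d * (a - v%:Z * c) = 1 + c * (b - v%:Z * d) by lia.
      nia.
    by rewrite pmulr_rgt0.
  - lia.
  - lia.
  - by apply/dvdzP; exists k.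
  have Ex : b%:Q / d%:Q = (b - v%:Z * d)%:Q / d%:Q + v%:Q.
    by rewrite intrB intrM; field; rewrite gt_eqF.
  by move: Hdiv; rewrite Ex => /(cf_divisibleD u v _ _ (dvdzz _)).
(* The quotient is in ]0, 1[, so L_u splits off on the left. *)
have udb : u%:Z * b < d.
  have x1 : 1 <= (b%:Q / d%:Q)^-1.
    by rewrite invf_div ler_pdivlMr // mul1r ler_int ltW.
  have HdivV : cf_divisible v u (b%:Q / d%:Q)^-1.
    by apply/cf_divisibleV => //; rewrite divr_ge0 // ltW.
  have := cf_divisible_ge _ _ _ x1 HdivV.
  rewrite invf_div ler_pdivlMr // -intrM ler_int.
  rewrite le_eqVlt => /predU1P[Ed|//].
  have : (u%:Z %| 1)%Z.
    by apply/dvdzP; exists (a * b - b * k); rewrite -[LHS]det Ek -Ed; ring.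
  by rewrite dvdz1 absz_nat; lia.
have -> : mx2 a b c d = Lmx u *m mx2 a b (c - u%:Z * a) (d - u%:Z * b).
  by rewrite mx2_mul; congr mx2; ring.
apply: in_monoid_M (in_monoid_L _ _) _; apply: IH => //.
- nia.
- have : 0 <= b * (c - u%:Z * a).
    have -> : b * (c - u%:Z * a) = a * (d - u%:Z * b) - 1 by lia.
    nia.
  by rewrite pmulr_rge0 // lt_def bn0.
- lia.
- lia.
- by apply/dvdzP; exists (k - a); rewrite Ek; ring.
have d'Q : 0 < (d - u%:Z * b)%:Q by rewrite ltr0z subr_gt0.
set e := (d - u%:Z * b)%:Q in d'Q *.
have Ee : d%:Q = u%:Q * b%:Q + e by rewrite /e intrB intrM; ring.
clearbody e.
have Ex : b%:Q / d%:Q = b%:Q / e / (u%:Q * (b%:Q / e) + 1).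
  by rewrite Ee; field; rewrite !gt_eqF // ltr_wpDl // mulr_ge0 // ltW.
have x'0 : 0 <= b%:Q / e by rewrite divr_ge0 // ltW.
by move: Hdiv; rewrite Ex => /(cf_divisible_Lmx _ _ _ u2 v2 x'0).
Qed.

Theorem theorem5 (u v : nat) (a b c d : int) :
  (2 <= u)%N -> (2 <= v)%N ->
  in_scrS u v (mx2 a b c d) ->
  (in_monoid u v (mx2 a b c d) <-> uv_divisible u v (cf_seq (b%:Q / d%:Q))).
Proof.
move=> u2 v2 [[_]]; rewrite mx2_det => det [n1 [n2 [n3 [n4 /matrixP EM]]]].
have := EM 0 0; have := EM 0 1; have := EM 1 0; have := EM 1 1.
rewrite !mxE /= => Ed Ec Eb Ea.
split=> [HM|]; last first.
  apply: in_monoid_of_cf_divisible => //; try lia.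
  by rewrite Ec PoszM dvdz_mulr.
have [_ _] := in_monoid_mobius _ _ _ _ u2 v2 HM (lexx 0) (cf_divisible0 u v).
by rewrite /mobius_num /mobius_den !mxE /= !mulr0 !add0r.
Qed.
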